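(* Let $G$ be a connected simple graph with $\chi(G)=3$ whose vertex set is partitioned into three independent sets $V_1=\{w\}$, $V_2=\{u_1,\ldots,u_x\}$ with $x\ge 2$, and $V_3=\{v_1,\ldots,v_y\}$ with $y\ge 2$, such that $w$ is adjacent to exactly $2a$ vertices of $V_2$ and exactly $2b$ vertices of $V_3$ for some integers $a,b\ge 1$, every vertex of $V_2$ has degree $2m$, and every vertex of $V_3$ has degree $2n$ (for some positive integers $m,n$). Then for every integer $t\ge 3$, $\chi_{la}(G[O_t])=3$.
   Context: For a graph $G=(V,E)$ with $q$ edges, a bijection $f:E\to\{1,\ldots,q\}$ is a local antimagic labeling if $f^+(u)\ne f^+(v)$ for all adjacent $u,v$, where $f^+(u)$ is the sum of labels of edges incident to $u$. $\chi_{la}(G)$ is the minimum number of distinct values of $f^+$ over all local antimagic labelings of $G$; $\chi(G)$ is the chromatic number. $O_t$ is the edgeless graph on $t$ vertices; $G[H]$ is the lexicographic product: vertex set $V(G)\times V(H)$, with $(u,u')\sim(v,v')$ iff $uv\in E(G)$, or $u=v$ and $u'v'\in E(H)$. *)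

(* Defs.v *)
From mathcomp Require Import all_boot.

Set Implicit Arguments.
Unset Strict Implicit.
Unset Printing Implicit Defensive.

Record sgraph := SGraph {
  vertex :> finType;
  adj : rel vertex;
  adj_sym : symmetric adj;
  adj_irrefl : irreflexive adj }.

Definition connected (G : sgraph) : Prop :=
  forall u v : G, connect (@adj G) u v.

Definition nbhd (G : sgraph) (u : G) : {set G} := [set v | adj u v].

Definition degree (G : sgraph) (u : G) : nat := #|nbhd u|.

Definition independent (G : sgraph) (S : {set G}) : Prop :=
  {in S &, forall u v : G, ~~ adj u v}.

Definition edges (G : sgraph) : {set {set G}} :=
  [set [set p.1; p.2] | p : G * G & adj p.1 p.2].

Definition is_minimum (P : nat -> Prop) (k : nat) : Prop :=
  P k /\ forall j : nat, P j -> k <= j.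

Definition colorable (G : sgraph) (k : nat) : Prop :=
  exists c : G -> 'I_k, forall u v : G, adj u v -> c u != c v.

Definition is_chromatic_number (G : sgraph) (k : nat) : Prop :=
  is_minimum (colorable G) k.

(* Only the values of f on edges of G matter. *)
Definition edge_labeling (G : sgraph) (f : {set G} -> nat) : Prop :=
  [/\ {in edges G, forall E : {set G}, 1 <= f E <= #|edges G|},
      {in edges G &, injective f}
    & forall i : nat, 1 <= i <= #|edges G| -> exists2 E, E \in edges G & f E = i].

Definition vertex_sum (G : sgraph) (f : {set G} -> nat) (u : G) : nat :=
  \sum_(E in edges G | u \in E) f E.

Definition local_antimagic (G : sgraph) (f : {set G} -> nat) : Prop :=
  edge_labeling f /\
  forall u v : G, adj u v -> vertex_sum f u != vertex_sum f v.

Definition num_colors (G : sgraph) (f : {set G} -> nat) : nat :=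
  size (undup [seq vertex_sum f u | u : G]).

(* A relation rather than a function: some graphs, such as K_2, have no local
   antimagic labeling, and then no k satisfies it. *)
Definition is_chi_la (G : sgraph) (k : nat) : Prop :=
  is_minimum
    (fun j => exists2 f : {set G} -> nat, local_antimagic f & num_colors f = j)
    k.

Definition edgeless_rel (t : nat) : rel 'I_t := fun _ _ => false.

Lemma edgeless_sym (t : nat) : symmetric (@edgeless_rel t).
Proof. by []. Qed.

Lemma edgeless_irrefl (t : nat) : irreflexive (@edgeless_rel t).
Proof. by []. Qed.

Definition edgeless (t : nat) : sgraph :=
  SGraph (@edgeless_sym t) (@edgeless_irrefl t).

Definition lex_rel (G H : sgraph) : rel (G * H) :=
  fun p q => adj p.1 q.1 || (p.1 == q.1) && adj p.2 q.2.

Lemma lex_sym (G H : sgraph) : symmetric (@lex_rel G H).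
Proof.
by move=> p q; rewrite /lex_rel adj_sym eq_sym [adj p.2 _]adj_sym.
Qed.

Lemma lex_irrefl (G H : sgraph) : irreflexive (@lex_rel G H).
Proof. by move=> p; rewrite /lex_rel !adj_irrefl andbF. Qed.

Definition lex_product (G H : sgraph) : sgraph :=
  SGraph (@lex_sym G H) (@lex_irrefl G H).

(* Main.v *)
(* Replacing every edge of G by a block K_{t,t} filled with a shifted semimagic
   square reduces the problem to labelling the edges of G by 0, ..., q - 1 so that
   all vertices of V_2 get one sum and all vertices of V_3 another.  Split the hub
   w into w', which keeps the neighbours in V_2, and w'', which keeps those in V_3.
   The result is bipartite with parts V_2 + w'' and V_3 + w', has even degrees, and
   is connected since otherwise G itself would be 2-colourable.  Along an Euler
   circuit from w', label the edges 0, q - 1, 1, q - 2, ...: consecutive labels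
   add up to q - 1 at each visit of V_2 and to q at each visit of V_3.  The sum at w
   then follows by double counting. *)

Require Import Defs.
From mathcomp Require Import all_boot.
From mathcomp Require Import zify.

Set Implicit Arguments.
Unset Strict Implicit.
Unset Printing Implicit Defensive.

(** * Semimagic squares of every order at least 3 *)

(** Entries are 0, ..., t^2 - 1 and diagonals are unconstrained; sums are doubled because the magic
    constant is t (t^2 - 1) / 2. *)
Definition semimagic (t : nat) (M : nat -> nat -> nat) : Prop :=
  [/\ forall i j, i < t -> j < t -> M i j < t * t,
      forall i j i' j', i < t -> j < t -> i' < t -> j' < t ->
        M i j = M i' j' -> i = i' /\ j = j',
      forall i, i < t -> (\sum_(j < t) M i j).*2 = t * (t * t).-1
    & forall j, j < t -> (\sum_(i < t) M i j).*2 = t * (t * t).-1].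

Lemma sum_ord_double t : (\sum_(i < t) i).*2 = t * t.-1.
Proof. by elim: t => [|t IH]; rewrite ?big_ord0 // big_ord_recr /= doubleD IH; nia. Qed.

Lemma sum_inj_modn t (f : nat -> nat) : 0 < t ->
  (forall i j, i < t -> j < t -> f i = f j %[mod t] -> i = j) ->
  \sum_(i < t) f i %% t = \sum_(i < t) i.
Proof.
move=> t0 f_inj; pose F (i : 'I_t) := Ordinal (ltn_pmod (f i) t0).
have F_inj : injective F by move=> i j /(congr1 val) /f_inj-/(_ (ltn_ord _) (ltn_ord _)) /val_inj.
by rewrite [RHS](reindex_inj F_inj).
Qed.

(** Two orthogonal Latin squares, [i + j] and [i + 2 j] modulo [t], supply the base [t] digits. The
    second is Latin because 2 is invertible modulo an odd [t]; together the digits determine [j] by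
    difference, then [i]. *)
Lemma semimagic_odd t : odd t -> exists M, semimagic t M.
Proof.
move=> t_odd; have t0 : 0 < t by case: t t_odd.
pose M i j := t * ((i + j) %% t) + (i + j.*2) %% t.
have modD i j k : i < t -> j < t -> k + i = k + j %[mod t] -> i = j.
  by move=> i_t j_t /eqP; rewrite eqn_modDl !modn_small // => /eqP.
have modDD i j k : i < t -> j < t -> k + i.*2 = k + j.*2 %[mod t] -> i = j.
  move=> i_t j_t /eqP; rewrite eqn_modDl -!muln2 => /eqP; wlog lij : i j i_t j_t / i <= j.
    by move=> W; case: (leqP i j) => [|/ltnW] l /esym e; [apply: W | apply/esym/W] => //.
  move=> /esym/eqP; rewrite eqn_mod_dvd ?leq_mul // -mulnBl Gauss_dvdl ?coprimen2 //.
  case: (posnP (j - i)) => [|d0 /(dvdn_leq d0)]; lia.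
exists M; split.
- move=> i j _ _; have := ltn_pmod (i + j) t0; have := ltn_pmod (i + j.*2) t0.
  rewrite /M; nia.
- move=> i j i' j' i_t j_t i'_t j'_t; rewrite /M !(mulnC t) => e.
  have := congr1 (divn^~ t) e; have := congr1 (modn^~ t) e.
  rewrite /= !modnMDl !modn_mod !divnMDl // !(divn_small (ltn_pmod _ t0)) !addn0 => e2 e1.
  have jj : j = j'.
    apply: (@modD _ _ (i + j)) => //; rewrite -addnA addnn e2 -addnn addnA.
    by apply/eqP; rewrite eqn_modDr; apply/eqP.
  by split=> //; apply: (@modD _ _ j) => //; rewrite !(addnC j) e1 jj.
- move=> i i_t; rewrite big_split -big_distrr /=.
  rewrite (sum_inj_modn (f := fun j => i + j)) ?(sum_inj_modn (f := fun j => i + j.*2)) //.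
  - by have := sum_ord_double t; nia.
  - by move=> j k; apply: modDD.
  - by move=> j k; apply: modD.
- move=> j j_t; rewrite big_split -big_distrr /=.
  rewrite (sum_inj_modn (f := fun i => i + j)) ?(sum_inj_modn (f := fun i => i + j.*2)) //.
  - by have := sum_ord_double t; nia.
  - by move=> i k ? ?; rewrite !(addnC _ j.*2); apply: modD.
  - by move=> i k ? ?; rewrite !(addnC _ j); apply: modD.
Qed.

(** Order 4 is given explicitly, as it cannot arise by doubling: there is no semimagic square of
    order 2. *)
Lemma semimagic4 : exists M, semimagic 4 M.
Proof.
pose s := [:: [:: 0; 14; 13; 3]; [:: 11; 5; 6; 8]; [:: 7; 9; 10; 4]; [:: 12; 2; 1; 15]].
exists (fun i j => nth 0 (nth [::] s i) j); split.
- by do 4?[case=> [|]] => //; do 4?[case=> [|]].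
- by do 4?[case=> [|]] => //; do 4?[case=> [|]] => //; do 4?[case=> [|]] => //;
    do 4?[case=> [|]].
- by do 4?[case=> [|]] => //; rewrite !big_ord_recl big_ord0.
- by do 4?[case=> [|]] => //; rewrite !big_ord_recl big_ord0.
Qed.

Lemma sum_ord2 h (f : nat -> nat) :
  \sum_(j < h.*2) f j = \sum_(j < h) (f j.*2 + f j.*2.+1).
Proof.
by elim: h => [|h IH]; rewrite ?big_ord0 // doubleS !big_ord_recr /= IH addnA.
Qed.

(** Each summand is 1, 2, 4 or 5 and the mean has to be 3: two blocks use 5 + 1, three use 5 + 2 +
    2, and every two further blocks add 1 + 5. *)
Lemma balanced_patterns h : 1 < h ->
  exists x y : nat -> bool, \sum_(j < h) (3 * x j + (y j).+1) = 3 * h.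
Proof.
elim/ltn_ind: h => -[|[|[|[|h]]]] // IH _.
- by exists (eq_op 0), (eq_op 0); rewrite !big_ord_recl big_ord0.
- by exists (eq_op 0), predT; rewrite !big_ord_recl big_ord0.
have [//|//|x [y xy]] := IH h.+2.
exists (fun j => if j < h.+2 then x j else j == h.+3).
exists (fun j => if j < h.+2 then y j else j == h.+3).
rewrite 2!big_ord_recr /= !ltnn (ltnNge h.+3) leqnSn /= eqxx.
rewrite (eq_bigr (fun j : 'I_h.+2 => 3 * x j + (y j).+1)) => [|j _]; last by rewrite ltn_ord.
by rewrite xy; lia.
Qed.

(* Blow up each entry of the square of order h to a 2 x 2 block; the pattern
   [[3 x, 1 + y], [3 - 3 x, 2 - y]] filling the blocks of a column of blocks has
   constant column sums, and the choice of x and y balances the rows. *)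
Lemma semimagic_double h : 1 < h -> (exists M, semimagic h M) -> exists M, semimagic h.*2 M.
Proof.
move=> h1 [M [Mlt Minj Mrow Mcol]]; have [x [y xy]] := balanced_patterns h1.
pose top j := if odd j then (y j./2).+1 else 3 * x j./2.
pose P i j := if odd i then 3 - top j else top j.
have P3 i j : P i j <= 3.
  by rewrite /P /top; case: (odd i) (odd j) (x _) (y _) => [] [] [] [].
have Pinj i j i' j' : j./2 = j'./2 -> P i j = P i' j' -> odd i = odd i' /\ odd j = odd j'.
  rewrite /P /top => ->.
  by case: (odd i) (odd j) (odd i') (odd j') (x _) (y _) => [] [] [] [] [] [].
exists (fun i j => 4 * M i./2 j./2 + P i j); split.
- move=> i j i_h j_h; have := Mlt i./2 j./2; have := P3 i j; lia.
- move=> i j i' j' i_h j_h i'_h j'_h e.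
  have [ii jj] : i./2 = i'./2 /\ j./2 = j'./2.
    by apply: Minj; have := P3 i j; have := P3 i' j'; lia.
  have eP : P i j = P i' j' by move: e; rewrite ii jj; lia.
  have [oi oj] := Pinj _ _ _ _ jj eP.
  by rewrite -(odd_double_half i) -(odd_double_half j) oi oj ii jj !odd_double_half.
- move=> i i_h; rewrite (sum_ord2 _ (fun j => 4 * M i./2 j./2 + P i j)).
  have i2 : i./2 < h by lia.
  have -> : \sum_(j < h) (4 * M i./2 j.*2./2 + P i j.*2 + (4 * M i./2 j.*2.+1./2 + P i j.*2.+1))
      = 8 * \sum_(j < h) M i./2 j + \sum_(j < h) (P i j.*2 + P i j.*2.+1).
    rewrite big_distrr -big_split; apply: eq_bigr => j _ /=.
    by rewrite uphalf_double doubleK; lia.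
  have -> : \sum_(j < h) (P i j.*2 + P i j.*2.+1) = 3 * h.
    have e : \sum_(j < h) (top j.*2 + top j.*2.+1) = 3 * h.
      rewrite -[RHS]xy; apply: eq_bigr => j _.
      by rewrite /top /= odd_double /= uphalf_double doubleK.
    rewrite /P; case: (odd i) => //.
    (* In an odd row each pattern entry is 3 minus the one above it, so the two rows together total
       6 h. *)
    have /eqP : \sum_(j < h) (top j.*2 + top j.*2.+1) +
        \sum_(j < h) (3 - top j.*2 + (3 - top j.*2.+1)) = 6 * h.
      rewrite -big_split /= (eq_bigr (fun=> 6)) ?sum_nat_const ?card_ord ?[_ * 6]mulnC // => j _.
      by have := P3 0 j.*2; have := P3 0 j.*2.+1; rewrite /P /=; lia.
    by rewrite e; lia.
  by have := Mrow _ i2; nia.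
- move=> j j_h; rewrite (sum_ord2 _ (fun i => 4 * M i./2 j./2 + P i j)).
  have j2 : j./2 < h by lia.
  have -> : \sum_(i < h) (4 * M i.*2./2 j./2 + P i.*2 j + (4 * M i.*2.+1./2 j./2 + P i.*2.+1 j))
      = 8 * \sum_(i < h) M i j./2 + 3 * h.
    have -> : 3 * h = \sum_(i < h) 3 by rewrite sum_nat_const card_ord mulnC.
    rewrite big_distrr -big_split; apply: eq_bigr => i _ /=.
    rewrite uphalf_double doubleK; have := P3 0 j.
    by rewrite /P /= odd_double /=; lia.
  by have := Mcol _ j2; nia.
Qed.

(** Halving an even order other than 4 leaves an order of at least 3, so the induction never reaches
    order 2. *)
Lemma semimagic_exists t : 2 < t -> exists M, semimagic t M.
Proof.
elim/ltn_ind: t => t IH t3; have [/semimagic_odd//|t_even] := boolP (odd t).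
have te : t = t./2.*2 by lia.
have [t4|t4] := eqVneq t 4; first by rewrite t4; apply: semimagic4.
by rewrite te; apply: semimagic_double; [|apply: IH]; lia.
Qed.

Lemma semimagic_onto t M k : semimagic t M -> k < t * t ->
  exists i j : 'I_t, M i j = k.
Proof.
case=> Mlt Minj _ _ kt.
pose F (p : 'I_t * 'I_t) := Ordinal (Mlt _ _ (ltn_ord p.1) (ltn_ord p.2)).
have F_inj : injective F.
  move=> [i j] [i' j'] /(congr1 val) /= /Minj.
  by case=> // /val_inj -> /val_inj ->.
have := inj_card_onto F_inj; rewrite card_prod !card_ord.
move=> /(_ (leqnn _) (Ordinal kt)) /codomP [[i j] /(congr1 val) /= e].
by exists i, j.
Qed.

(** * Edges, incidence and vertex sums *)

Lemma edgesP (G : sgraph) (E : {set G}) :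
  reflect (exists u v : G, adj u v /\ E = [set u; v]) (E \in edges G).
Proof.
apply: (iffP imsetP) => [[[u v] /=]|[u [v [uv ->]]]]; first by rewrite inE => uv ->; exists u, v.
by exists (u, v); rewrite ?inE.
Qed.

Lemma adj_neq (G : sgraph) (u v : G) : adj u v -> u != v.
Proof. by apply: contraTneq => ->; rewrite adj_irrefl. Qed.

Lemma mem_edges2 (G : sgraph) (u v : G) : adj u v -> [set u; v] \in edges G.
Proof. by move=> uv; apply/edgesP; exists u, v. Qed.

Lemma set2_inj (T : finType) (u : T) : injective (fun v => [set u; v]).
Proof.
move=> v v' /setP e; have := e v; have := e v'; rewrite !inE !eqxx !orbT.
by case: eqVneq => [->|_] /=; [case: eqVneq => [->//|_] /= _ /esym/eqP | move=> /eqP].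
Qed.

Lemma incident_edges (G : sgraph) (u : G) :
  [set E in edges G | u \in E] = [set [set u; v] | v in nbhd u].
Proof.
apply/setP=> E; rewrite inE; apply/andP/imsetP => [[/edgesP[x [y [xy ->]]]]|[v]].
  rewrite !inE => /orP[/eqP->|/eqP->]; first by exists y; rewrite ?inE.
  by exists x; rewrite ?inE 1?adj_sym // setUC.
by rewrite inE => uv ->; rewrite mem_edges2 // set21.
Qed.

Lemma sum_incident (G : sgraph) (F : {set G} -> nat) (u : G) :
  vertex_sum F u = \sum_(v | adj u v) F [set u; v].
Proof.
rewrite /vertex_sum (eq_bigl [in [set [set u; v] | v in nbhd u]]) => [|E]; last first.
  by rewrite -incident_edges inE.
rewrite big_imset /= => [|v v' _ _]; last exact: set2_inj.
by apply: eq_bigl => v; rewrite inE.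
Qed.

Lemma card_incident (G : sgraph) (u : G) : #|[set E in edges G | u \in E]| = degree u.
Proof. by rewrite incident_edges card_imset //; apply: set2_inj. Qed.

(** * Trails and Euler circuits *)

(** The edges of the walk [x :: p] in order, possibly repeated; [uniq] is what makes it a genuine
    trail. *)
Definition trail (G : sgraph) (x : G) (p : seq G) : seq {set G} :=
  pairmap (fun u v => [set u; v]) x p.

Lemma trail_sub (G : sgraph) (x : G) p :
  path (@adj G) x p -> {subset trail x p <= edges G}.
Proof.
elim: p x => //= y p IH x /andP[xy /IH sub] E; rewrite inE => /predU1P[->|/sub//].
exact: mem_edges2.
Qed.

Lemma trail_cat (G : sgraph) (x : G) p1 p2 :
  trail x (p1 ++ p2) = trail x p1 ++ trail (last x p1) p2.
Proof. exact: pairmap_cat. Qed.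

Lemma trail_ends (G : sgraph) (x u v : G) p :
  [set u; v] \in trail x p -> (u \in x :: p) && (v \in x :: p).
Proof.
elim: p x => //= y p IH x; rewrite inE => /predU1P[e|/IH]; last first.
  by rewrite !(in_cons x) => /andP[-> ->]; rewrite !orbT.
have : u \in [set x; y] by rewrite -e set21.
have : v \in [set x; y] by rewrite -e set22.
by rewrite !inE => /orP[]/eqP-> /orP[]/eqP->; rewrite !eqxx ?orbT.
Qed.

(** Every inner visit to [v] uses two edges, so only the two ends of the walk affect the parity. *)
Lemma trail_parity (G : sgraph) (x v : G) p : path (@adj G) x p ->
  odd (count (fun E : {set G} => v \in E) (trail x p)) = (x == v) (+) (last x p == v).
Proof.
elim: p x => [|y p IH] x /=; first by rewrite addbb.
move=> /andP[/adj_neq xy /IH]; rewrite oddD => ->; rewrite !inE addbA !(eq_sym v).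
congr (_ (+) _); case: (eqVneq x v) xy => [->|_ _]; last by case: (y == v).
by rewrite eq_sym => /negbTE->.
Qed.

Lemma count_edges_sub (G : sgraph) (s : seq {set G}) (v : G) :
  uniq s -> {subset s <= edges G} ->
  (forall E, E \in edges G -> v \in E -> E \in s) ->
  count (fun E : {set G} => v \in E) s = degree v.
Proof.
move=> s_uniq s_sub s_all; rewrite -card_incident -size_filter.
rewrite -(card_uniqP (filter_uniq _ s_uniq)); apply: eq_card => E; rewrite !inE mem_filter.
by apply/andP/andP => [[-> /s_sub ->]|[Ee vE]] //; rewrite vE s_all.
Qed.

(** Serves to append an edge at any vertex of a closed trail, and to choose where an Euler circuit
    starts. *)
Lemma trail_rotate (G : sgraph) (x y : G) p :
  path (@adj G) x p -> last x p = x -> y \in x :: p ->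
  exists p', [/\ path (@adj G) y p', last y p' = y & perm_eq (trail y p') (trail x p)].
Proof.
move=> px lx y_p; case/splitPl: y_p px lx => p1 p2 e1; rewrite cat_path last_cat e1.
case/andP=> px1 px2 e2; exists (p2 ++ p1); rewrite cat_path last_cat e2 px2 px1 e1.
by split=> //; rewrite !trail_cat e1 e2 perm_catC.
Qed.

Lemma trail_extend (G : sgraph) (x : G) p :
    (forall x : G, ~~ odd (degree x)) -> connected G ->
    path (@adj G) x p -> uniq (trail x p) ->
  (last x p = x /\ trail x p =i edges G) \/
  exists y p', [/\ path (@adj G) y p', uniq (trail y p') & size p' = (size p).+1].
Proof.
move=> G_even G_conn px up; have sub := trail_sub px.
have extend y p' z : path (@adj G) y p' -> uniq (trail y p') -> adj (last y p') z ->
    [set last y p'; z] \notin trail y p' -> size p' = size p ->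
    exists y p', [/\ path (@adj G) y p', uniq (trail y p') & size p' = (size p).+1].
  move=> py uy yz new sz; exists y, (rcons p' z); rewrite rcons_path py yz size_rcons sz.
  by split=> //; rewrite -cats1 trail_cat cats1 rcons_uniq new.
have [lx|nlx] := eqVneq (last x p) x; last first.
  right; have [z /andP[lz new]|none] := pickP [pred z | adj (last x p) z &
      [set last x p; z] \notin trail x p]; first exact: (extend x p z).
  (* If all edges at the end of an open trail were used, their number would be both odd and the even
     degree. *)
  have := trail_parity (last x p) px; rewrite eqxx eq_sym (negbTE nlx).
  rewrite count_edges_sub ?(negbTE (G_even _)) // => E /edgesP[u [v [uv ->]]].
  rewrite !inE => /orP[]/eqP e; move: (none u) (none v); rewrite /= -?e.
    by rewrite e uv /= => _ /negbFE.
  by rewrite e [adj v u]adj_sym uv /= setUC => /negbFE.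
have [[z v] /= /and3P[z_p zv new]|none] := pickP [pred zv : G * G |
    [&& zv.1 \in x :: p, adj zv.1 zv.2 & [set zv.1; zv.2] \notin trail x p]].
  have [p' [pz lz e]] := trail_rotate px lx z_p.
  right; apply: (extend z p' v); rewrite ?lz ?(perm_uniq e) ?(perm_mem e) //.
  by have := perm_size e; rewrite /trail !size_pairmap.
have in_trail u v : u \in x :: p -> adj u v -> [set u; v] \in trail x p.
  by move=> u_p uv; have := none (u, v); rewrite /= u_p uv /= => /negbFE.
have all_in u : u \in x :: p.
  have /connectP[s ps ->] := G_conn x u.
  have : x \in x :: p by rewrite inE eqxx.
  elim: s {1 2 4}x ps => //= v s IH z /andP[zv /IH{}IH] z_p; apply: IH.
  by have /trail_ends/andP[] := in_trail _ _ z_p zv.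
left; split=> // E; apply/idP/idP => [/sub//|/edgesP[u [v [uv ->]]]].
exact: in_trail.
Qed.

(** Extension must stop, as a trail has at most as many edges as the graph; [k] below bounds the
    remaining room. *)
Lemma euler_circuit (G : sgraph) (r : G) :
    (forall x : G, ~~ odd (degree x)) -> connected G ->
  exists p, [/\ path (@adj G) r p, last r p = r, uniq (trail r p) & trail r p =i edges G].
Proof.
move=> G_even G_conn.
have longest k x p : path (@adj G) x p -> uniq (trail x p) -> #|edges G| <= size p + k ->
    exists y p', [/\ path (@adj G) y p', last y p' = y, uniq (trail y p')
                   & trail y p' =i edges G].
  elim: k x p => [|k IH] x p px up le;
    have [[lx e]|[y [p' [py uy sz]]]] := trail_extend G_even G_conn px up.
  - by exists x, p.
  - have := uniq_leq_size uy (s2 := enum (edges G)) _; rewrite -cardE size_pairmap sz.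
    have sub : {subset trail y p' <= enum (edges G)}.
      by move=> E /(trail_sub py); rewrite mem_enum.
    by move=> /(_ sub); move: le; rewrite addn0 => /leq_ltn_trans le /le; rewrite ltnn.
  - by exists x, p.
  - by apply: (IH y p') => //; rewrite sz addSnnS.
have [x [p [px lx up e]]] := longest #|edges G| r [::] isT isT (leqnn _).
(* Either [r] is the start, or connectivity gives [r] an edge, which the circuit traverses. *)
have r_p : r \in x :: p.
  have /connectP[s] := G_conn r x; case: s => [_ ->|z s /= /andP[rz _] _].
    by rewrite inE eqxx.
  have : [set r; z] \in trail x p by rewrite e mem_edges2.
  by case/trail_ends/andP.
have [p' [pr lr perm]] := trail_rotate px lx r_p.
exists p'; rewrite (perm_uniq perm); split=> // E; rewrite (perm_mem perm); exact: e.
Qed.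

(** * Alternating labels along an Euler circuit *)

Definition zigzag (q i : nat) : nat := if odd i then q - i./2.+1 else i./2.

Lemma zigzag_lt h i : i < h.*2 -> zigzag h.*2 i < h.*2.
Proof. by rewrite /zigzag; case: ifP; lia. Qed.

Lemma zigzag_inj h i j : i < h.*2 -> j < h.*2 ->
  zigzag h.*2 i = zigzag h.*2 j -> i = j.
Proof. by rewrite /zigzag; case: ifP; case: ifP; lia. Qed.

(** [P] marks the circuit edges at one vertex. They pair up at positions 2 k and 2 k + 1, with
    labels k and 2 h - k - 1. *)
Lemma zigzag_sum_even h (P : pred nat) :
  (forall k, k < h -> P k.*2 = P k.*2.+1) ->
  (\sum_(i < h.*2) P i * zigzag h.*2 i).*2 = h.*2.-1 * \sum_(i < h.*2) P i.
Proof.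
move=> PP; rewrite (sum_ord2 _ (fun i => P i * zigzag h.*2 i)) (sum_ord2 _ P).
rewrite -muln2 big_distrl big_distrr; apply: eq_bigr => k _ /=.
rewrite /zigzag /= odd_double /= uphalf_double doubleK -PP //.
have := ltn_ord k; nia.
Qed.

(** Here the pairs sit at positions 2 k + 1 and 2 k + 2, with labels 2 h - k - 1 and k + 1; the
    first and last edges stay unpaired and must be unmarked. *)
Lemma zigzag_sum_odd h (P : pred nat) :
  (forall k, k.+1 < h -> P k.*2.+1 = P k.*2.+2) -> P 0 = false -> P h.*2.-1 = false ->
  (\sum_(i < h.*2) P i * zigzag h.*2 i).*2 = h.*2 * \sum_(i < h.*2) P i.
Proof.
case: h => [|h] PP P0 Pl; first by rewrite !big_ord0.
have ends (f : nat -> nat) : \sum_(i < h.+1.*2) f i = f 0 + \sum_(i < h.*2) f i.+1 + f h.*2.+1.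
  by rewrite doubleS big_ord_recl big_ord_recr /= addnA.
rewrite (ends (fun i => P i * zigzag h.+1.*2 i)) (ends P) P0 Pl mul0n !addn0 !add0n.
rewrite (sum_ord2 _ (fun i => P i.+1 * zigzag h.+1.*2 i.+1)) (sum_ord2 _ (fun i => P i.+1)).
rewrite -muln2 big_distrl big_distrr; apply: eq_bigr => k _ /=.
rewrite /zigzag /= odd_double /= uphalf_double doubleK -PP ?ltnS //.
have := ltn_ord k; nia.
Qed.

Lemma sum_tour (G : sgraph) (s : seq {set G}) (F : nat -> nat) (u : G) :
  uniq s -> s =i edges G ->
  vertex_sum (fun E => F (index E s)) u = \sum_(i < size s) (u \in nth set0 s i) * F i.
Proof.
move=> s_uniq s_all; rewrite /vertex_sum.
transitivity (\sum_(E <- s) (u \in E) * F (index E s)).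
  rewrite big_uniq //= [RHS](eq_bigl [in edges G]); last by move=> E; rewrite s_all.
  by rewrite big_mkcondr; apply: eq_bigr => E _; case: (u \in E); rewrite ?mul1n.
rewrite (big_nth set0) big_mkord; apply: eq_bigr => i _.
by rewrite index_uniq.
Qed.

Lemma degree_sum (G : sgraph) (u : G) : degree u = vertex_sum (fun=> 1) u.
Proof. by rewrite sum_incident sum1_card /degree; apply: eq_card => v; rewrite inE. Qed.

Lemma degree_tour (G : sgraph) (s : seq {set G}) (u : G) :
  uniq s -> s =i edges G -> degree u = \sum_(i < size s) (u \in nth set0 s i).
Proof.
move=> s_uniq s_all; rewrite degree_sum (sum_tour (fun=> 1) _ s_uniq s_all).
by apply: eq_bigr => i _; rewrite muln1.
Qed.

Lemma mem_trail_nth (G : sgraph) (x r : G) p i : i < size p ->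
  (x \in nth set0 (trail r p) i) = (x == nth r (r :: p) i) || (x == nth r (r :: p) i.+1).
Proof. by move=> ip; rewrite /trail (nth_pairmap r) // !inE. Qed.

Lemma side_nth (G : sgraph) (side : pred G) (r : G) p i :
  (forall x y : G, adj x y -> side x != side y) -> path (@adj G) r p -> i <= size p ->
  side (nth r (r :: p) i) = side r (+) odd i.
Proof.
move=> sideN pr; elim: i => [|i IH] ip; first by rewrite addbF.
have /sideN := pathP r pr i ip; rewrite IH ?(ltnW ip) //=.
by case: (side _) (side _) (odd i) => [] [] [].
Qed.

(** The circuit from [r] alternates sides, so [side] vertices occur at odd positions and the others
    at even ones. The root is excluded because its closing visit joins the first and last labels, 0
    and q / 2, instead of a pair with sum q. *)
Lemma bipartite_labeling (G : sgraph) (side : pred G) (r : G) :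
    connected G -> (forall x : G, ~~ odd (degree x)) ->
    (forall x y : G, adj x y -> side x != side y) -> side r = false ->
  exists g : {set G} -> nat,
  [/\ ~~ odd #|edges G|, {in edges G, forall E, g E < #|edges G|}, {in edges G &, injective g},
      forall x, side x -> (vertex_sum g x).*2 = #|edges G|.-1 * degree x
    & forall x, ~~ side x -> x != r -> (vertex_sum g x).*2 = #|edges G| * degree x].
Proof.
move=> G_conn G_even sideN side_r.
have [p [pr lr up all_p]] := euler_circuit r G_even G_conn.
have sz_p : size (trail r p) = size p by rewrite size_pairmap.
have q_p : #|edges G| = size p.
  by rewrite -sz_p -(card_uniqP up); apply: eq_card => E; rewrite all_p.
have nth_last : nth r (r :: p) (size p) = r by rewrite -last_nth.
have p_even : ~~ odd (size p).
  by have := side_nth sideN pr (leqnn _); rewrite nth_last side_r /= => <-.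
rewrite q_p; move: (size p)./2 (even_halfK p_even) => h e_h.
have sideE x i : i <= size p -> side x != odd i -> (x == nth r (r :: p) i) = false.
  move=> ip sx; apply: contraNF sx => /eqP->.
  by rewrite (side_nth sideN pr ip) side_r.
exists (fun E => zigzag (size p) (index E (trail r p))).
have idx E : E \in edges G -> index E (trail r p) < size p.
  by rewrite -all_p -index_mem sz_p.
split=> // [E /idx|E E' Ee E'e|x sx|x sx xr].
- by rewrite -e_h; apply: zigzag_lt.
- move: (idx _ Ee) (idx _ E'e); rewrite -e_h => i1 i2 /(zigzag_inj i1 i2) e.
  by rewrite -(nth_index set0 (s := trail r p) (x := E)) ?all_p // e nth_index ?all_p.
- rewrite (degree_tour _ up all_p) (sum_tour (zigzag _) _ up all_p) sz_p.
  rewrite -e_h; apply: (zigzag_sum_even (P := fun i => x \in nth set0 (trail r p) i)) => k k_h.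
  rewrite !mem_trail_nth; [|lia..].
  rewrite (sideE _ k.*2) ?(sideE _ k.*2.+2) ?orbF ?sx //=; lia.
- rewrite (degree_tour _ up all_p) (sum_tour (zigzag _) _ up all_p) sz_p.
  have [h0|h0] := posnP h; first by rewrite -e_h h0 !big_ord0.
  rewrite -e_h; apply: (zigzag_sum_odd (P := fun i => x \in nth set0 (trail r p) i)) => [k k_h||].
  + rewrite !mem_trail_nth; [|lia..].
    rewrite (sideE _ k.*2.+1) ?(sideE _ k.*2.+3) ?orbF //=; lia.
  + rewrite mem_trail_nth; last by lia.
    by rewrite (negbTE xr) (sideE _ 1) //; lia.
  (* The last edge runs from an odd position, excluded by the side of [x], back to the root. *)
  + rewrite mem_trail_nth; last by lia.
    rewrite prednK; last by lia.
    rewrite (sideE _ h.*2.-1); [|lia..].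
    by rewrite e_h nth_last (negbTE xr).
Qed.

(** * Splitting the hub into two vertices *)

Definition unsplit_hub (G : sgraph) (w : G) (x : option G) : G := odflt w x.

(** [None] joins the side of [A] because its neighbours lie outside [A]; [Some w] falls on the other
    side once [w] is not in [A]. *)
Definition split_side (G : sgraph) (A : {set G}) (x : option G) : bool :=
  if x is Some u then u \in A else true.

(* The hub w becomes Some w, which keeps its neighbours in A, and None, which
   gets the others. *)
Definition split_rel (G : sgraph) (w : G) (A : {set G}) : rel (option G) :=
  fun x y => adj (unsplit_hub w x) (unsplit_hub w y) && (split_side A x != split_side A y).

Lemma split_sym (G : sgraph) (w : G) (A : {set G}) : symmetric (split_rel w A).
Proof. by move=> x y; rewrite /split_rel adj_sym eq_sym. Qed.

Lemma split_irrefl (G : sgraph) (w : G) (A : {set G}) : irreflexive (split_rel w A).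
Proof. by move=> x; rewrite /split_rel adj_irrefl. Qed.

Definition split_graph (G : sgraph) (w : G) (A : {set G}) : sgraph :=
  SGraph (split_sym w A) (split_irrefl w A).

(** Lifts an edge to the split graph. Under [hub_partition] an edge avoiding [A] contains [w], which
    then lifts to [None]. *)
Definition split_edge (G : sgraph) (w : G) (A : {set G}) (E : {set G}) :
    {set split_graph w A} :=
  if [disjoint E & A] then None |: Some @: (E :\ w) else Some @: E.

Definition hub_partition (G : sgraph) (w : G) (A : {set G}) : Prop :=
  [/\ w \notin A, independent A & independent (~: (w |: A))].

Section SplitHub.

Variables (G : sgraph) (w : G) (A : {set G}).
Hypothesis hubA : hub_partition w A.

Local Notation B := (split_graph w A).
Local Notation pr := (@unsplit_hub G w).

Let wA : w \notin A. Proof. by case: hubA. Qed.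

Let adjA u v : adj u v -> u \in A -> v \notin A.
Proof. by case: hubA => _ indA _ uv uA; apply: contraTN uv; apply: indA. Qed.

Let adjNA u v : adj u v -> u != w -> u \notin A -> v \notin A -> v = w.
Proof.
case: hubA => _ _ indC uv uw uA vA; apply/eqP; apply: contraTT uv => vw.
by apply: indC; rewrite !inE negb_or ?uw ?vw.
Qed.

Lemma split_edge2 (x y : B) : adj x y -> split_edge w A [set pr x; pr y] = [set x; y].
Proof.
wlog sx : x y / split_side A x => [wl|].
  case sx: (split_side A x) => xy; first exact: wl.
  have yx : adj y x by rewrite adj_sym.
  rewrite setUC [RHS]setUC; apply: wl => //.
  by case/andP: xy; rewrite sx; case: (split_side A y).
case/andP=> xy; rewrite sx; case: y xy => [v|] //= xy vA.
rewrite /split_edge; case: x sx xy => [u|] /= uA uv.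
  have /negbTE-> : ~~ [disjoint [set u; v] & A].
    by apply/pred0Pn; exists u; rewrite /= uA set21.
  by rewrite imsetU1 imset_set1.
have -> : [disjoint [set w; v] & A].
  rewrite disjoints_subset; apply/subsetP => z; rewrite !inE.
  by case/orP => /eqP->; rewrite // eq_sym eqb_id in vA.
congr (_ |: _); rewrite setU1K ?imset_set1 // inE; exact: adj_neq.
Qed.

Lemma split_adj (u v : G) : adj u v -> exists x y : B, [/\ adj x y, pr x = u & pr y = v].
Proof.
move=> uv; have vu : adj v u by rewrite adj_sym.
have [uA|uA] := boolP (u \in A).
  by exists (Some u), (Some v); rewrite /= /split_rel /= uv uA (negbTE (adjA uv uA)).
have [vA|vA] := boolP (v \in A).
  by exists (Some u), (Some v); rewrite /= /split_rel /= uv vA (negbTE uA).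
have [ew|nuw] := eqVneq u w.
  by exists None, (Some v); rewrite /= /split_rel /= -ew uv (negbTE vA).
by exists (Some u), None; rewrite /= /split_rel /= -(adjNA uv nuw uA vA) uv (negbTE uA).
Qed.

Lemma unsplit_adj (x y : B) : adj x y -> adj (pr x) (pr y).
Proof. by case/andP. Qed.

Lemma split_edge_imset : split_edge w A @: edges G = edges B.
Proof.
apply/setP=> E; apply/imsetP/idP => [[_ /edgesP[u [v [/split_adj[x [y [xy <- <-]]] ->]]] ->]|].
  by rewrite split_edge2 // mem_edges2.
case/edgesP=> x [y [xy ->]]; exists [set pr x; pr y]; rewrite ?split_edge2 //.
by rewrite mem_edges2 // unsplit_adj.
Qed.

Lemma split_edgeK : {in edges G, cancel (split_edge w A) (fun E => pr @: E)}.
Proof.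
move=> _ /edgesP[_ [_ [/split_adj[x [y [xy <- <-]]] ->]]].
by rewrite split_edge2 // imsetU1 imset_set1.
Qed.

Lemma split_edge_inj : {in edges G &, injective (split_edge w A)}.
Proof. exact: can_in_inj split_edgeK. Qed.

Lemma card_split_edges : #|edges B| = #|edges G|.
Proof. by rewrite -split_edge_imset card_in_imset //; apply: split_edge_inj. Qed.

(** Away from the hub, [u] has the single preimage [Some u], so incidence is preserved by the edge
    bijection. *)
Lemma split_vertex_sum (g : {set B} -> nat) (u : G) : u != w ->
  vertex_sum (g \o split_edge w A) u = vertex_sum g (Some u : B).
Proof.
move=> uw; rewrite /vertex_sum -split_edge_imset [RHS]big_mkcondr big_imset /=; last first.
  exact: split_edge_inj.
rewrite big_mkcondr; apply: eq_bigr => _ /edgesP[_ [_ [/split_adj[x [y [xy <- <-]]] ->]]].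
rewrite split_edge2 // !inE.
have prE z : (u == pr z) = (Some u == z) by case: z => //=; apply/negbTE.
by rewrite !prE.
Qed.

Lemma split_degree (u : G) : u != w -> degree (Some u : B) = degree u.
Proof. by move=> uw; rewrite !degree_sum -(split_vertex_sum (fun=> 1) uw). Qed.

Lemma split_degree_hub : degree (Some w : B) = #|nbhd w :&: A|.
Proof.
have Some_injG : injective (@Some G) by move=> ? ? [].
rewrite /degree -(card_imset _ Some_injG); apply: eq_card => x.
apply/idP/imsetP => [|[v]]; rewrite !inE.
  case: x => [v|] /andP[/= wv]; last by rewrite adj_irrefl in wv.
  by rewrite (negbTE wA) eq_sym eqbF_neg negbK => vA; exists v; rewrite // !inE wv.
by case/andP=> wv vA ->; rewrite /= /split_rel /= wv vA (negbTE wA).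
Qed.

Lemma split_degree_None : degree (None : B) = #|nbhd w :\: A|.
Proof.
have Some_injG : injective (@Some G) by move=> ? ? [].
rewrite /degree -(card_imset _ Some_injG); apply: eq_card => x.
apply/idP/imsetP => [|[v]]; rewrite !inE.
  case: x => [v|] /andP[/= wv] //= vA; exists v; rewrite // !inE wv andbT.
  by move: vA; case: (v \in A).
by case/andP=> vA wv ->; rewrite /= /split_rel /= wv (negbTE vA).
Qed.

(* If the two halves of w were in different components, then swapping the two
   sides of the component of None would turn the bipartition of the split graph
   into a proper 2-colouring of G. *)
Lemma split_connected : connected G -> ~ colorable G 2 -> connected B.
Proof.
move=> G_conn G_n2; pose C (x : B) := connect (@adj B) (Some w) x.
have csym : connect_sym (@adj B).
  by apply: sym_connect_sym => x y; rewrite adj_sym.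
have Cadj x y : adj x y -> C x = C y.
  move=> xy; apply: (same_connect_r csym); exact: connect1.
have CNone : C None.
  apply: contra_notT G_n2 => NC.
  pose c u := (u \in A) (+) ~~ C (Some u).
  exists (fun u => inord (c u)) => u v /split_adj[x [y [xy <- <-]]] {u v}.
  have cE z : c (pr z) = split_side A z (+) ~~ C z.
    case: z => [z|] //=; rewrite /c (negbTE wA) (negbTE NC) /=.
    by rewrite /C connect0.
  apply/eqP => /(congr1 (@nat_of_ord 2)); rewrite !inordK ?ltnS ?leq_b1 // !cE (Cadj _ _ xy).
  by case/andP: xy => _; case: (split_side _ x) (split_side _ y) (C y) => [] [] [].
(* A path of [G] lifts edge by edge; at the hub the lift may switch between [Some w] and [None],
   both of which lie in the component. *)
have CSome u : C (Some u).
  have /connectP[p pw ->] := G_conn w u.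
  have : C (Some w) by apply: connect0.
  elim: p {1 2 3}w pw => //= v p IH z /andP[zv /IH{}IH] Cz; apply: IH.
  have [x [y [xy ex ey]]] := split_adj zv.
  have Cx : C x by case: x ex {xy} => //= x ->.
  rewrite (Cadj _ _ xy) in Cx; case: y ey Cx {xy} => [y /= -> //|/= <- _].
  exact: connect0.
have all_C x : C x by case: x.
by move=> x y; apply: connect_trans (all_C y); rewrite csym; apply: all_C.
Qed.

(** Rooting the circuit at [Some w] hides the exceptional vertex in the hub, whose sum is left open
    here. *)
Lemma hub_labeling :
    connected G -> ~ colorable G 2 -> (forall u, u != w -> ~~ odd (degree u)) ->
    ~~ odd #|nbhd w :&: A| -> ~~ odd #|nbhd w :\: A| ->
  exists g : {set G} -> nat,
  [/\ ~~ odd #|edges G|, {in edges G, forall E, g E < #|edges G|}, {in edges G &, injective g},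
      {in A, forall u, (vertex_sum g u).*2 = #|edges G|.-1 * degree u}
    & {in ~: (w |: A), forall u, (vertex_sum g u).*2 = #|edges G| * degree u}].
Proof.
move=> G_conn G_n2 G_even wA_even wNA_even.
have B_even (x : B) : ~~ odd (degree x).
  case: x => [u|]; last by rewrite split_degree_None.
  have [->|uw] := eqVneq u w; first by rewrite split_degree_hub.
  by rewrite split_degree // G_even.
have sideN (x y : B) : adj x y -> split_side A x != split_side A y by case/andP.
have [g [q_even g_lt g_inj g_A g_NA]] :=
  bipartite_labeling (split_connected G_conn G_n2) B_even sideN
    (negbTE wA : split_side A (Some w) = false).
rewrite card_split_edges in q_even g_lt g_A g_NA.
have eB E : E \in edges G -> split_edge w A E \in edges B.
  by move=> Ee; rewrite -split_edge_imset imset_f.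
exists (g \o split_edge w A); split=> // [E /eB/g_lt //|E E' Ee E'e /= /g_inj e|u uA|u].
- by apply: split_edge_inj => //; apply: e; apply: eB.
- have uw : u != w by apply: contraNneq wA => <-.
  by rewrite split_vertex_sum // -split_degree // g_A.
- rewrite !inE negb_or => /andP[uw uA].
  by rewrite split_vertex_sum // -split_degree // g_NA.
Qed.

End SplitHub.

(** * Counting with bijective labels *)

Lemma card_of_labels (T : finType) (A : {set T}) (f : T -> nat) N :
  {in A, forall x, 1 <= f x <= N} -> {in A &, injective f} ->
  (forall i, 1 <= i <= N -> exists2 x, x \in A & f x = i) -> #|A| = N.
Proof.
move=> f_le f_inj f_onto; rewrite cardE -(size_map f) -[RHS](size_iota 1).
apply/perm_size/uniq_perm; rewrite ?iota_uniq //.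
  by rewrite map_inj_in_uniq ?enum_uniq // => x y; rewrite !mem_enum; apply: f_inj.
move=> i; rewrite mem_iota add1n ltnS; apply/mapP/idP => [[x]|/f_onto[x xA <-]].
  by rewrite mem_enum => /f_le fx ->.
by exists x; rewrite ?mem_enum.
Qed.

Lemma onto_of_inj (T : finType) (A : {set T}) (f : T -> nat) k :
  {in A, forall x, f x < #|A|} -> {in A &, injective f} -> k < #|A| ->
  exists2 x, x \in A & f x = k.
Proof.
move=> f_lt f_inj kA.
have s_uniq : uniq [seq f x | x <- enum A].
  by rewrite map_inj_in_uniq ?enum_uniq // => x y; rewrite !mem_enum; apply: f_inj.
have sub : {subset [seq f x | x <- enum A] <= iota 0 #|A|}.
  by move=> _ /mapP[x xA ->]; rewrite mem_iota f_lt // -mem_enum.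
have [|_ e] := uniq_min_size s_uniq sub; first by rewrite size_iota size_map cardE.
have : k \in iota 0 #|A| by rewrite mem_iota.
by rewrite -e => /mapP[x]; rewrite mem_enum => xA ->; exists x.
Qed.

(** Weighted handshake lemma: each edge is counted at its two ends. *)
Lemma sum_vertex_sums (G : sgraph) (F : {set G} -> nat) :
  \sum_u vertex_sum F u = (\sum_(E in edges G) F E).*2.
Proof.
rewrite /vertex_sum (exchange_big_dep [in edges G]) => [|u E _ /andP[]//] /=.
rewrite -muln2 big_distrl; apply: eq_bigr => E Ee /=.
rewrite sum_nat_const mulnC; congr (_ * _).
have [u [v [uv ->]]] := edgesP _ Ee.
rewrite -[RHS](_ : #|[set u; v]| = 2); last by rewrite cards2 adj_neq.
by apply: eq_card => x; rewrite !inE mem_edges2 // !inE.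
Qed.

Lemma sum_labels (T : finType) (A : {set T}) (f : T -> nat) :
  {in A, forall x, f x < #|A|} -> {in A &, injective f} ->
  (\sum_(x in A) f x).*2 = #|A| * #|A|.-1.
Proof.
move=> f_lt f_inj; rewrite -sum_ord_double; congr _.*2.
rewrite -big_enum -(big_map f predT id) /= -(big_mkord predT id).
apply: perm_big; apply: uniq_perm; rewrite ?iota_uniq //.
  by rewrite map_inj_in_uniq ?enum_uniq // => x y; rewrite !mem_enum; apply: f_inj.
move=> k; rewrite mem_index_iota; apply/mapP/idP => [[x]|/(onto_of_inj f_lt f_inj)[x xA <-]].
  by rewrite mem_enum => /f_lt fx ->.
by exists x; rewrite ?mem_enum.
Qed.

(** * Labelling the lexicographic product block by block *)

Section LexLabeling.

Variables (G : sgraph) (g : {set G} -> nat) (t : nat) (M : nat -> nat -> nat).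
Hypotheses (M_magic : semimagic t M).
Hypotheses (g_lt : {in edges G, forall E, g E < #|edges G|}).
Hypotheses (g_inj : {in edges G &, injective g}).

Local Notation H := (lex_product G (edgeless t)).

(** Orients each edge by the enumeration of [G], to decide which end of its block indexes the rows
    of [M] and which the columns. *)
Definition forward (p : H * H) : bool :=
  adj p.1.1 p.2.1 && (enum_rank p.1.1 < enum_rank p.2.1).

(** The block over an edge with label [k] receives k t^2 + 1, ..., k t^2 + t^2, arranged as in [M].
    The value 0 occurs only on sets that are not edges. *)
Definition lex_label (E : {set H}) : nat :=
  if [pick p : H * H | (E == [set p.1; p.2]) && forward p] is Some p
  then (g [set p.1.1; p.2.1] * (t * t) + M p.1.2 p.2.2).+1 else 0.

Lemma lex_adjE (x y : H) : adj x y = adj x.1 y.1.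
Proof. by rewrite /= /lex_rel andbF orbF. Qed.

Lemma forward_total (x y : H) : adj x y -> forward (x, y) || forward (y, x).
Proof.
rewrite lex_adjE => xy; rewrite /forward /= xy [adj y.1 _]adj_sym xy /=.
by rewrite -neq_ltn; apply: contra_neq (adj_neq xy) => /val_inj/enum_rank_inj.
Qed.

(** The picked pair is unique, since no two vertices are [forward] in both orders. *)
Lemma lex_labelE (x y : H) : forward (x, y) ->
  lex_label [set x; y] = (g [set x.1; y.1] * (t * t) + M x.2 y.2).+1.
Proof.
move=> fxy; rewrite /lex_label; case: pickP => [[x' y'] /=|/(_ (x, y))]; last first.
  by rewrite /= eqxx fxy.
case/andP=> /eqP e f'.
have xy : x != y by apply: contraTneq fxy => ->; rewrite /forward ltnn andbF.
have : x \in [set x'; y'] by rewrite -e set21.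
have : y \in [set x'; y'] by rewrite -e set22.
rewrite !inE => /orP[]/eqP ey /orP[]/eqP ex; subst x y; rewrite ?eqxx // in xy *.
by move: fxy f' => /andP[_ /= /ltnW]; rewrite leqNgt /forward => /negbTE->; rewrite andbF.
Qed.

Lemma lex_edgeP (E : {set H}) : E \in edges H ->
  exists2 p : H * H, forward p & E = [set p.1; p.2].
Proof.
case/edgesP=> x [y [/forward_total/orP[f|f] ->]]; first by exists (x, y).
by exists (y, x) => //; rewrite setUC.
Qed.

Lemma forward_adj (p : H * H) : forward p -> adj p.1.1 p.2.1.
Proof. by case/andP. Qed.

(** Division by t^2 recovers the edge of [G] from the quotient and the cell of [M] from the
    remainder; the orientation then fixes the order of the ends. *)
Lemma lex_label_inj : {in edges H &, injective lex_label}.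
Proof.
have [Mlt Minj _ _] := M_magic.
move=> _ _ /lex_edgeP[[[u i] [v j]] f ->] /lex_edgeP[[[u' i'] [v' j']] f' ->].
rewrite !lex_labelE // => -[e].
have {}Mlt (a b : 'I_t) : M a b < t * t by apply: Mlt.
have eg : g [set u; v] = g [set u'; v'].
  have tt0 : 0 < t * t by apply: leq_ltn_trans (Mlt i j).
  by have := congr1 (divn^~ (t * t)) e; rewrite /= !divnMDl // !divn_small // !addn0.
have eM : M i j = M i' j' by move: e; rewrite /= eg => /addnI.
have [/val_inj -> /val_inj ->] := Minj _ _ _ _ (ltn_ord i) (ltn_ord j) (ltn_ord i') (ltn_ord j') eM.
have es : [set u; v] = [set u'; v'].
  by apply: g_inj eg; apply: mem_edges2; [apply: forward_adj f | apply: forward_adj f'].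
have : u \in [set u'; v'] by rewrite -es set21.
have : v \in [set u'; v'] by rewrite -es set22.
have uv := adj_neq (forward_adj f); rewrite /= in uv.
rewrite !inE => /orP[]/eqP ev /orP[]/eqP eu; subst u v; rewrite ?eqxx // in uv *.
by move: f f' => /andP[_ /= /ltnW]; rewrite leqNgt /forward /= => /negbTE->; rewrite andbF.
Qed.

Lemma lex_label_le : {in edges H, forall E, 1 <= lex_label E <= #|edges G| * (t * t)}.
Proof.
have [Mlt _ _ _] := M_magic.
move=> _ /lex_edgeP[[[u i] [v j]] f ->]; rewrite lex_labelE //=.
have := Mlt i j (ltn_ord i) (ltn_ord j).
have := g_lt (mem_edges2 (forward_adj f)); rewrite /=; nia.
Qed.

Lemma lex_label_onto k : 1 <= k <= #|edges G| * (t * t) ->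
  exists2 E, E \in edges H & lex_label E = k.
Proof.
case: k => // k /= k_lt; have tt0 : 0 < t * t by case: (t * t) k_lt => //; rewrite muln0.
have [|E Ee gE] := onto_of_inj g_lt g_inj (k := k %/ (t * t)); first by rewrite ltn_divLR.
have [i [j Mij]] := semimagic_onto M_magic (ltn_pmod k tt0).
have [u [v [uv eE]]] := edgesP _ Ee.
suff [u' [v' [f {}eE]]] : exists u' v', forward ((u', i), (v', j)) /\ E = [set u'; v'].
  exists [set ((u', i) : H); (v', j)]; last by rewrite lex_labelE //= -eE gE Mij -divn_eq.
  by apply: (@mem_edges2 H); rewrite lex_adjE; apply: forward_adj f.
have /forward_total/orP[] : adj ((u, i) : H) (v, j) by rewrite lex_adjE.
  by exists u, v.
by exists v, u; rewrite eE setUC.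
Qed.

Lemma card_lex_edges : #|edges H| = #|edges G| * (t * t).
Proof. exact: card_of_labels lex_label_le lex_label_inj lex_label_onto. Qed.

Lemma lex_edge_labeling : edge_labeling lex_label.
Proof.
split; rewrite ?card_lex_edges; [exact: lex_label_le | exact: lex_label_inj |].
exact: lex_label_onto.
Qed.

(** For each neighbour of [u] the vertex sees a full row or a full column of [M], and these have
    equal sums, so the orientation does not matter. *)
Lemma lex_vertex_sum (u : G) (i : 'I_t) :
  (vertex_sum lex_label ((u, i) : H)).*2 =
  (t * (t * t) * vertex_sum g u).*2 + degree u * (t * (t * t).+1).
Proof.
have [_ _ Mrow Mcol] := M_magic.
have -> : vertex_sum lex_label ((u, i) : H) =
    \sum_(v | adj u v) \sum_(j < t) lex_label [set ((u, i) : H); (v, j)].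
  rewrite sum_incident pair_big /=.
  by apply: eq_big => [p|[v j] _] //; rewrite /lex_rel andbF orbF andbT.
rewrite degree_sum !sum_incident.
rewrite -!muln2 big_distrr !big_distrl -big_split; apply: eq_bigr => v uv /=.
have -> : \sum_(j < t) lex_label [set ((u, i) : H); (v, j)] =
    \sum_(j < t) (if enum_rank u < enum_rank v then M i j else M j i) +
    t * (g [set u; v] * (t * t)).+1.
  rewrite -[X in X * _](card_ord t) -sum_nat_const -big_split; apply: eq_bigr => j _ /=.
  rewrite addnS; case: ifP => uv_rank.
    by rewrite lex_labelE 1?addnC // /forward /= uv.
  have /forward_total : adj ((u, i) : H) (v, j) by rewrite lex_adjE.
  rewrite {1}/forward /= uv_rank andbF /= => f.
  by rewrite setUC lex_labelE //= [[set v; u]]setUC addnC.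
have t0 : 0 < t by apply: leq_ltn_trans (ltn_ord i).
set r := \sum_(j < t) _.
have : r.*2 = t * (t * t).-1.
  by rewrite /r; case: (enum_rank u < enum_rank v); [apply: Mrow | apply: Mcol].
by move: r => r; nia.
Qed.

End LexLabeling.

(** * Lower bound by colouring, and separation of the three colours *)

Lemma colorable_num_colors (G : sgraph) (f : {set G} -> nat) :
  local_antimagic f -> colorable G (num_colors f).
Proof.
case=> _ f_adj; rewrite /colorable /num_colors; set s := undup _.
have s_in u : vertex_sum f u \in s by rewrite mem_undup; apply/mapP; exists u; rewrite ?mem_enum.
have idx u : index (vertex_sum f u) s < size s by rewrite index_mem.
exists (fun u => Ordinal (idx u)) => u v /f_adj; apply: contra_neq => /(congr1 val) /= e.
by rewrite -(nth_index 0 (s_in u)) e nth_index.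
Qed.

Lemma colorable_lex (G H : sgraph) (x : H) k : colorable (lex_product G H) k -> colorable G k.
Proof.
case=> c c_adj; exists (fun u => c (u, x)) => u v uv; apply: c_adj.
by rewrite /= /lex_rel /= uv.
Qed.

(* The colours in units of t, with p = q t^2 + 1: the colours of the two parts
   are m p and n (p + t^2), and that of the hub is (a + b) p + (a - q / 2) t^2;
   they are distinct because the multiples of t^2 involved lie strictly between
   0 and p. *)
Lemma colors_distinct (a b m n h s : nat) : 0 < s -> 0 < n ->
  m + b <= h -> n + a < h -> 0 < b ->
  let p := 2 * h * s + 1 in
  [/\ m * p != n * (p + s), (a + b) * p + a * s != m * p + h * s
    & (a + b) * p + a * s != n * (p + s) + h * s].
Proof.
move=> s0 n0 mh nh b0 p.
have ps : h * s + h * s < p by rewrite /p; nia.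
have ns : n * s < h * s by rewrite ltn_mul2r s0; lia.
have as_ : a * s < h * s by rewrite ltn_mul2r s0; lia.
have nsa : n * s + a * s < h * s by rewrite -mulnDl ltn_mul2r s0; lia.
have ns0 : 0 < n * s by rewrite muln_gt0 n0.
have gap x y d : d < p -> x * p + d = y * p -> d = 0.
  by move=> dp /(congr1 (modn^~ p)); rewrite /= modnMDl modnMl modn_small.
clearbody p; split; apply/eqP; rewrite ?mulnDr => e.
- by have := gap n m (n * s); lia.
- by have := gap m (a + b) (h * s - a * s); lia.
- by have := gap n (a + b) (n * s + h * s - a * s); lia.
Qed.

(** * Edge counts around the hub and the resulting three colours *)

Theorem theorem2p13 (G : sgraph) (w : G) (V1 V2 V3 : {set G}) (a b m n : nat)
  (G_conn : connected G)
  (G_chi : is_chromatic_number G 3)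
  (V_cover : V1 :|: V2 :|: V3 = [set: G])
  (V12_disj : [disjoint V1 & V2])
  (V13_disj : [disjoint V1 & V3])
  (V23_disj : [disjoint V2 & V3])
  (V1_indep : independent V1)
  (V2_indep : independent V2)
  (V3_indep : independent V3)
  (V1_def : V1 = [set w])
  (V2_card : 2 <= #|V2|)
  (V3_card : 2 <= #|V3|)
  (a_ge1 : 1 <= a) (b_ge1 : 1 <= b)
  (m_gt0 : 0 < m) (n_gt0 : 0 < n)
  (w_V2 : #|nbhd w :&: V2| = 2 * a)
  (w_V3 : #|nbhd w :&: V3| = 2 * b)
  (V2_deg : forall u : G, u \in V2 -> degree u = 2 * m)
  (V3_deg : forall v : G, v \in V3 -> degree v = 2 * n)
  (t : nat) (t_ge3 : 3 <= t) :
  is_chi_la (lex_product G (edgeless t)) 3.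
Proof.
have wV1 : w \in V1 by rewrite V1_def set11.
have w2 : w \notin V2 by apply: contraTN V12_disj => w2; apply/pred0Pn; exists w; rewrite /= wV1.
have w3 : w \notin V3 by apply: contraTN V13_disj => w3; apply/pred0Pn; exists w; rewrite /= wV1.
have V3E : V3 = ~: (w |: V2).
  apply/setP=> u; move/setP/(_ u): V_cover; rewrite V1_def !inE.
  have [->|_ /=] := eqVneq u w; first by rewrite (negbTE w3).
  have [u2 _|_ /= ->//] := boolP (u \in V2).
  by apply: contraTF V23_disj => u3; apply/pred0Pn; exists u; rewrite /= u2.
have hub2 : hub_partition w V2 by split; rewrite -?V3E.
have uV u : u != w -> (u \in V2) || (u \in V3).
  by move=> uw; rewrite V3E !inE (negbTE uw) orbN.
have G_n2 : ~ colorable G 2 by move/(G_chi.2 _).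
have wV3 : nbhd w :\: V2 = nbhd w :&: V3.
  apply/setP=> u; rewrite V3E !inE negb_or andbC; case uw: (adj w u) => //=.
  by rewrite eq_sym adj_neq.
have G_even u : u != w -> ~~ odd (degree u).
  by case/uV/orP => [/V2_deg|/V3_deg] ->; rewrite mul2n odd_double.
have [||g [q_even g_lt g_inj g2 g3]] := hub_labeling hub2 G_conn G_n2 G_even.
- by rewrite w_V2 mul2n odd_double.
- by rewrite wV3 w_V3 mul2n odd_double.
have sumG (F : G -> nat) : \sum_u F u = F w + (\sum_(u in V2) F u + \sum_(u in V3) F u).
  rewrite (bigD1 w) //= (bigID [in V2]) /=; congr (_ + (_ + _)); apply: eq_bigl => u.
    by have [->|] := eqVneq u w; rewrite ?(negbTE w2).
  by rewrite V3E !inE negb_or.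
have deg_w : degree w = 2 * a + 2 * b.
  by rewrite -w_V2 -w_V3 -wV3 /degree cardsID.
have degE u : degree u = \sum_v adj u v.
  rewrite /degree -sum1_card big_mkcond; apply: eq_bigr => v _.
  by rewrite inE; case: (adj u v).
have card_w (S : {set G}) : #|nbhd w :&: S| = \sum_(v in S) adj v w.
  rewrite -sum1_card big_mkcond [RHS]big_mkcond; apply: eq_bigr => v _.
  by rewrite !inE adj_sym; case: (adj v w) (v \in S) => [] [].
have indep0 (S : {set G}) u : independent S -> u \in S -> \sum_(v in S) adj u v = 0.
  by move=> indS uS; apply: big1 => v vS; rewrite (negbTE (indS _ _ uS vS)).
set q := #|edges G| in q_even g_lt g2 g3.
(* [K] counts the edges between [V2] and [V3]; it links the degree sums of the two parts. *)
set K := \sum_(u in V2) \sum_(v in V3) adj u v.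
have e2 : #|V2| * (2 * m) = 2 * a + K.
  rewrite -w_V2 card_w -big_split -sum_nat_const; apply: eq_bigr => u u2 /=.
  by rewrite -(V2_deg _ u2) degE sumG indep0.
have e3 : #|V3| * (2 * n) = 2 * b + K.
  rewrite -w_V3 card_w /K exchange_big -big_split -sum_nat_const; apply: eq_bigr => u u3 /=.
  rewrite -(V3_deg _ u3) degE sumG [X in _ + (_ + X)]indep0 // addn0.
  by congr (_ + _); apply: eq_bigr => v _; rewrite adj_sym.
have eH : 2 * q = 2 * a + 2 * b + (#|V2| * (2 * m) + #|V3| * (2 * n)).
  have : \sum_(u : G) degree u = q.*2.
    by rewrite (eq_bigr _ (fun u _ => degree_sum u)) sum_vertex_sums sum1_card.
  rewrite sumG deg_w (eq_bigr _ V2_deg) (eq_bigr _ V3_deg) !sum_nat_const.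
  by move=> e; lia.
(* Half the number of edges: eliminating [K] gives q / 2 both as |V2| m + b and as |V3| n + a. *)
set h := #|V2| * m + b.
have q_h : q = 2 * h by rewrite /h; lia.
have h_n : h = #|V3| * n + a by rewrite /h; lia.
have {}g2 u : u \in V2 -> vertex_sum g u = q.-1 * m.
  by move=> u2; have := g2 u u2; rewrite V2_deg //; nia.
have {}g3 u : u \in V3 -> vertex_sum g u = q * n.
  by rewrite V3E => u3; have := g3 u u3; rewrite V3_deg ?V3E //; nia.
have q0 : 0 < q by rewrite q_h /h; lia.
(* All vertex sums total q (q - 1); subtracting the shares (h - b) (q - 1) of [V2] and (h - a) q of
   [V3] leaves the hub. *)
have gw : vertex_sum g w + h = b * q.-1 + a * q.
  have := sum_vertex_sums g; rewrite sumG (eq_bigr _ g2) (eq_bigr _ g3) !sum_nat_const.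
  rewrite sum_labels // -/q mulnCA [X in _ + (_ + X)]mulnCA => e.
  have e1 : q.-1 * (#|V2| * m) + b * q.-1 = h * q.-1 by rewrite mulnC -mulnDl.
  have e4 : q * (#|V3| * n) + a * q = h * q by rewrite mulnC -mulnDl h_n.
  have e5 : h * q.-1 + h = h * q by rewrite addnC -mulnS prednK.
  have e6 : q * q.-1 = h * q.-1 + h * q.-1 by rewrite -mulnDl addnn -mul2n -q_h.
  by lia.
have t0 : 0 < t := leq_trans (isT : 0 < 3) t_ge3.
have [M M_magic] := semimagic_exists t_ge3.
set f := lex_label g (t := t) M.
set s := t * t; set p := 2 * h * s + 1.
have s0 : 0 < s by rewrite muln_gt0 t0.
have [c23 cw2 cw3] : [/\ m * p != n * (p + s), (a + b) * p + a * s != m * p + h * s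
    & (a + b) * p + a * s != n * (p + s) + h * s].
  (* The strict bound [n + a < h] comes from [V3] having at least two vertices. *)
  apply: colors_distinct => //; last by rewrite h_n ltn_add2r ltn_Pmull.
  by rewrite leq_add2r leq_pmull // (leq_trans _ V2_card).
have f2 u (i : 'I_t) : u \in V2 -> vertex_sum f (u, i) = t * (m * p).
  move=> u2; have := lex_vertex_sum g M_magic u i.
  rewrite g2 // V2_deg // /p -q_h -[in q * s](prednK q0).
  by move: (vertex_sum _ _) q.-1 => S q'; clear; lia.
have f3 u (i : 'I_t) : u \in V3 -> vertex_sum f (u, i) = t * (n * (p + s)).
  move=> u3; have := lex_vertex_sum g M_magic u i.
  rewrite g3 // V3_deg // /p -q_h.
  by move: (vertex_sum _ _) (q) => S q'; clear; lia.
have fw (i : 'I_t) : vertex_sum f (w, i) + t * (h * s) = t * ((a + b) * p + a * s).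
  have := lex_vertex_sum g M_magic w i; have := congr1 (muln (t * s)) gw.
  rewrite deg_w /p -q_h -[in q * s](prednK q0) -[in a * q](prednK q0).
  by move: (vertex_sum f _) (vertex_sum g w) q.-1 (h) => S z q' h'; clear; lia.
(* By [fw] this subtraction is exact, not truncated. *)
pose cw := t * ((a + b) * p + a * s) - t * (h * s).
pose color u := if u == w then cw else t * (if u \in V2 then m * p else n * (p + s)).
have fE u (i : 'I_t) : vertex_sum f (u, i) = color u.
  rewrite /color; have [->|uw] := eqVneq u w; first by rewrite /cw -(fw i) addnK.
  by have [/f2->|u2] := boolP (u \in V2); rewrite ?f3 //; move: (uV u uw); rewrite (negbTE u2).
have cwE : cw + t * (h * s) = t * ((a + b) * p + a * s).
  by rewrite -(fw (Ordinal t0)) fE /color eqxx.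
have cw_neq k : (a + b) * p + a * s != k + h * s -> cw != t * k.
  by apply: contra_neq => e; apply/eqP; rewrite -(eqn_pmul2l t0) -cwE e mulnDr.
have color_adj u v : adj u v -> color u != color v.
  wlog uw : u v / u != w => [wl uv|uv].
    have [uw|] := eqVneq u w; last by move/wl; apply.
    by rewrite eq_sym; apply: wl; [rewrite -uw eq_sym adj_neq | rewrite adj_sym].
  rewrite /color (negbTE uw); have [vw|vw] := eqVneq v w.
    by rewrite eq_sym; case: ifP => _; apply: cw_neq.
  have [u2|u2] := boolP (u \in V2); have [v2|v2] := boolP (v \in V2).
  - by case/negP: (V2_indep _ _ u2 v2).
  - by rewrite eqn_pmul2l.
  - by rewrite eqn_pmul2l // eq_sym.
  - have := uV u uw; have := uV v vw; rewrite (negbTE u2) (negbTE v2) /= => v3 u3.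
    by case/negP: (V3_indep _ _ u3 v3).
have f_antimagic : local_antimagic f.
  split; first exact: lex_edge_labeling.
  by move=> [u i] [v j]; rewrite lex_adjE !fE => /color_adj.
(* The sums of any local antimagic labeling colour the product, hence the copy of [G] inside it,
   whose chromatic number is 3. *)
have ge3 j (f' : {set lex_product G (edgeless t)} -> nat) :
    local_antimagic f' -> num_colors f' = j -> 3 <= j.
  move=> /colorable_num_colors c <-; apply: G_chi.2.
  exact: (@colorable_lex _ (edgeless t) (Ordinal t0)) c.
split; last by move=> j [f' f'_la]; apply: ge3.
exists f => //; apply/eqP; rewrite eqn_leq (ge3 _ f) // andbT.
apply: (@leq_trans (size [:: cw; t * (m * p); t * (n * (p + s))])) => //.
apply: uniq_leq_size (undup_uniq _) _ => c; rewrite mem_undup => /mapP[[u i] _ ->].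
by rewrite fE /color !inE; case: ifP => _; [|case: ifP => _]; rewrite eqxx ?orbT.
Qed.
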